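(* Let $n$ be a nonnegative integer and let $p(q)=a_0+qa_1+q^2a_2+\dots+q^na_n$ be a polynomial of degree $n$ in an octonionic variable $q\in\mathbb{O}$, with real coefficients $a_0,\dots,a_n\in\mathbb{R}$ satisfying $$0<a_0\leq a_1\leq\dots\leq a_n.$$ Then all the zeros of $p$ in $\mathbb{O}$ lie in $|q|\leq 1$; that is, if $q\in\mathbb{O}$ and $p(q)=0$, then $|q|\leq 1$.
   Context: $\mathbb{O}$ denotes the (nonassociative, alternative) real division algebra of octonions, with real basis $e_0=1,e_1,\dots,e_7$ and multiplication $e_\alpha e_\beta=-\delta_{\alpha\beta}+\sum_{\gamma=1}^7\psi_{\alpha\beta\gamma}e_\gamma$ for $\alpha,\beta\in\{1,\dots,7\}$, where $\psi$ is totally antisymmetric, equals $1$ on the triples $(1,2,3),(1,4,5),(2,4,6),(3,4,7),(2,5,7),(1,7,6),(5,3,6)$, and vanishes on triples not obtained by permuting one of these. Every octonion is $\omega=\sum_{k=0}^7x_ke_k$ with $x_k\in\mathbb{R}$, and $|\omega|=\left(\sum_{k=0}^7x_k^2\right)^{1/2}$. Real numbers are identified with the multiples of $e_0=1$. Powers $q^k$ are unambiguous since $\mathbb{O}$ is power-associative. *)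

(* Defs.v *)
From mathcomp Require Import all_boot all_order all_algebra.
From mathcomp Require Import reals.

Set Implicit Arguments.
Unset Strict Implicit.
Unset Printing Implicit Defensive.

Import Order.TTheory GRing.Theory Num.Theory.

Local Open Scope ring_scope.

Definition psi_triples : seq (nat * nat * nat) :=
  [:: (1, 2, 3); (1, 4, 5); (2, 4, 6); (3, 4, 7);
      (2, 5, 7); (1, 7, 6); (5, 3, 6)]%N.

(* The first test runs over the even permutations of (a, b, c), the second    *)
(* over the odd ones.                                                         *)
Definition psi (a b c : nat) : int :=
  if has (mem psi_triples) [:: (a, b, c); (b, c, a); (c, a, b)] then 1
  else if has (mem psi_triples) [:: (b, a, c); (a, c, b); (c, b, a)] then -1
  else 0.

Lemma psi_antisym (a b c : 'I_8) :
  psi b a c = - psi a b c /\ psi a c b = - psi a b c.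
Proof.
have chk : all (fun i => all (fun j => all (fun k =>
    (psi j i k == - psi i j k) && (psi i k j == - psi i j k))
  (iota 0 8)) (iota 0 8)) (iota 0 8) by vm_compute.
have io (i : 'I_8) : (i : nat) \in iota 0 8 by rewrite mem_iota /=.
move/allP: chk => /(_ _ (io a)) /allP /(_ _ (io b)) /allP /(_ _ (io c)).
by case/andP => /eqP -> /eqP ->.
Qed.

(* Coordinates are taken in the basis e_0 = 1, e_1, ..., e_7. The product is  *)
(* not associative, so it is kept apart from the ring structures of MathComp. *)
Definition octonion (R : realType) := 'rV[R]_8.

Section Octonion.
Variable R : realType.
Implicit Types (x y q : octonion R) (p : {poly R}).

Definition obasis (i : 'I_8) : octonion R := delta_mx 0 i.

Definition obasis_mul (i j : 'I_8) : octonion R :=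
  if i == ord0 then obasis j
  else if j == ord0 then obasis i
  else - (i == j)%:R *: obasis ord0
       + \sum_(k < 8 | k != ord0) (psi i j k)%:~R *: obasis k.

Definition omul x y : octonion R :=
  \sum_(i < 8) \sum_(j < 8) (x 0 i * y 0 j) *: obasis_mul i j.

Definition oreal (r : R) : octonion R := r *: obasis ord0.

Definition onorm x : R := Num.sqrt (\sum_(k < 8) x 0 k ^+ 2).

Definition oexp q (k : nat) : octonion R := iter k (omul q) (oreal 1).

Definition ohorner p q : octonion R :=
  \sum_(k < size p) omul (oexp q k) (oreal p`_k).

End Octonion.

(* Main.v *)
Require Import Defs.
From mathcomp Require Import all_boot all_order all_algebra.
From mathcomp Require Import reals complex.
From mathcomp Require Import ring.

(** The real subalgebra generated by an octonion q is a copy of a subalgebra of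
    the complex numbers: since q^2 = 2 Re(q) q - |q|^2, powers of q reduce to
    the span of 1 and q exactly as powers of z = Re(q) + i |Im(q)| do.  A zero q
    of p therefore gives a complex zero z with |z| = |q|, and the classical
    Enestrom-Kakeya argument, comparing the two sides of
    (z - 1) p(z) = a_n z^(n+1) - (a_0 + sum_k (a_k - a_(k-1)) z^k), applies. *)

Set Implicit Arguments.
Unset Strict Implicit.
Unset Printing Implicit Defensive.

Import Order.TTheory GRing.Theory Num.Theory.

Local Open Scope ring_scope.

Lemma enestrom_kakeya (C : numDomainType) (n : nat) (a : nat -> C) (z : C) :
  0 < a 0%N -> (forall k, (k < n)%N -> a k <= a k.+1) ->
  \sum_(k < n.+1) a k * z ^+ k = 0 -> `|z| <= 1.
Proof.
(* The order of [C] may be partial, but norms are real, so the negation of the goal does give 1 <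
   |z|. *)
move=> a0 ale az0; rewrite real_leNgt ?normr_real ?real1 //; apply/negP => z1.
(* Induction on partial sums: passing from m to m+1 adds (a_(m+1) - a_m) z^(m+1) to the remainder,
   and |z| > 1 lets the old bound a_m |z|^m grow to a_m |z|^(m+1). At m = n the zero leaves
   |z|^(n+1) <= |z|^n, a contradiction. *)
have remainder m : (m <= n)%N -> 0 < a m /\
    `|a m * z ^+ m.+1 - (z - 1) * \sum_(k < m.+1) a k * z ^+ k|
      <= a m * `|z| ^+ m.
  elim: m => [_|m IH lemn].
    split=> //; rewrite big_ord1 /= !expr0 !mulr1 expr1.
    have -> : a 0%N * z - (z - 1) * a 0%N = a 0%N by ring.
    by rewrite gtr0_norm.
  have [am IHm] := IH (ltnW lemn); have leam := ale _ lemn.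
  split; first exact: lt_le_trans am leam.
  set D := _ - _ in IHm.
  have -> : a m.+1 * z ^+ m.+2 - (z - 1) * \sum_(k < m.+2) a k * z ^+ k
      = D + (a m.+1 - a m) * z ^+ m.+1.
    by rewrite /D big_ord_recr /= (exprS z m.+1); ring.
  apply: le_trans (ler_normD _ _) _.
  rewrite normrM normrX (ger0_norm (_ : 0 <= a m.+1 - a m)) ?subr_ge0 //.
  have -> : a m.+1 * `|z| ^+ m.+1
      = a m * `|z| ^+ m.+1 + (a m.+1 - a m) * `|z| ^+ m.+1 by ring.
  rewrite lerD2r; apply: le_trans IHm _.
  by rewrite ler_pM2l // ler_weXn2l ?ltW.
have [an] := remainder n (leqnn n).
rewrite az0 mulr0 subr0 normrM normrX gtr0_norm // ler_pM2l //.
by rewrite ler_eXn2l // ltnn.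
Qed.

Section Octonion.
Variable R : realType.
Implicit Types (x y q : octonion R) (p : {poly R}).

Lemma octonion_sum x : x = \sum_(k < 8) x 0 k *: obasis R k.
Proof. exact: row_sum_delta. Qed.

Lemma omulDr x y1 y2 : omul x (y1 + y2) = omul x y1 + omul x y2.
Proof.
rewrite /omul -big_split; apply: eq_bigr => i _ /=.
rewrite -big_split; apply: eq_bigr => j _ /=.
by rewrite mxE mulrDr scalerDl.
Qed.

Lemma omulZr x (r : R) y : omul x (r *: y) = r *: omul x y.
Proof.
rewrite /omul scaler_sumr; apply: eq_bigr => i _.
rewrite scaler_sumr; apply: eq_bigr => j _.
by rewrite mxE scalerA mulrCA.
Qed.

Lemma omulr1 x : omul x (obasis R ord0) = x.
Proof.
rewrite {2}[x]octonion_sum; apply: eq_bigr => i _.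
rewrite (bigD1 ord0) //= big1 => [|j j0]; last first.
  by rewrite mxE (negPf j0) andbF mulr0 scale0r.
rewrite addr0 mxE !eqxx mulr1 /obasis_mul eqxx.
by case: (i =P ord0) => [->|].
Qed.

Lemma omul_oreal x (r : R) : omul x (oreal r) = r *: x.
Proof. by rewrite omulZr omulr1. Qed.

(** Antisymmetry of [psi] in its first two indices cancels the structure constants, so only the real
    part survives when both units are imaginary. *)
Lemma obasis_mul_symm (i j : 'I_8) :
  obasis_mul R i j + obasis_mul R j i
  = ((i == ord0)%:R *: obasis R j + (j == ord0)%:R *: obasis R i
     - (i == j)%:R *: obasis R ord0) *+ 2.
Proof.
rewrite /obasis_mul; case: (i =P ord0) => [->|i0]; case: (j =P ord0) => [->|j0].
- by rewrite eqxx !scale1r addrK mulr2n.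
- have /negPf -> : ord0 != j by apply/eqP => /esym.
  by rewrite scale1r !scale0r addr0 subr0 mulr2n.
- have /negPf -> : i != ord0 by apply/eqP.
  by rewrite scale1r !scale0r add0r subr0 mulr2n.
have -> : \sum_(k < 8 | k != ord0) (psi j i k)%:~R *: obasis R k
    = - \sum_(k < 8 | k != ord0) (psi i j k)%:~R *: obasis R k.
  rewrite -sumrN; apply: eq_bigr => k _.
  by rewrite (psi_antisym i j k).1 rmorphN scaleNr.
rewrite (eq_sym j i) !scale0r !add0r addrACA subrr addr0.
by rewrite scaleNr mulr2n.
Qed.

(** Adding to the double sum for q^2 its copy with indices exchanged leaves only anticommutators of
    basis units. Their three terms sum to Re(q) q, Re(q) q and -|q|^2. *)
Lemma omul_square q :
  omul q q = (q 0 ord0 *+ 2) *: q - (\sum_(k < 8) q 0 k ^+ 2) *: obasis R ord0.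
Proof.
have twice : omul q q *+ 2 = \sum_(i < 8) \sum_(j < 8)
    (q 0 i * q 0 j) *: (obasis_mul R i j + obasis_mul R j i).
  rewrite mulr2n {2}/omul exchange_big /omul -big_split.
  apply: eq_bigr => i _ /=; rewrite -big_split; apply: eq_bigr => j _ /=.
  by rewrite (mulrC (q 0 j)) scalerDr.
have two_neq0 : 2%:R != 0 :> R by rewrite pnatr_eq0.
apply: (scalerI two_neq0); rewrite !scaler_nat twice.
have -> : \sum_(i < 8) \sum_(j < 8)
    (q 0 i * q 0 j) *: (obasis_mul R i j + obasis_mul R j i)
  = (\sum_(i < 8) \sum_(j < 8) (q 0 i * q 0 j) *: ((i == ord0)%:R *: obasis R j)
    + \sum_(i < 8) \sum_(j < 8) (q 0 i * q 0 j) *: ((j == ord0)%:R *: obasis R i)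
    - \sum_(i < 8) \sum_(j < 8)
        (q 0 i * q 0 j) *: ((i == j)%:R *: obasis R ord0)) *+ 2.
  rewrite -big_split -sumrB -sumrMnl; apply: eq_bigr => i _ /=.
  rewrite -big_split -sumrB -sumrMnl; apply: eq_bigr => j _ /=.
  by rewrite obasis_mul_symm -scalerMnr scalerBr scalerDr.
have e1 : \sum_(i < 8) \sum_(j < 8)
    (q 0 i * q 0 j) *: ((i == ord0)%:R *: obasis R j) = q 0 ord0 *: q.
  rewrite (bigD1 ord0) //= [X in _ + X]big1 => [|i /negPf i0]; last first.
    by apply: big1 => j _; rewrite i0 scale0r scaler0.
  rewrite addr0 [X in _ = _ *: X]octonion_sum scaler_sumr.
  by apply: eq_bigr => j _; rewrite scale1r scalerA.
have e2 : \sum_(i < 8) \sum_(j < 8)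
    (q 0 i * q 0 j) *: ((j == ord0)%:R *: obasis R i) = q 0 ord0 *: q.
  rewrite exchange_big -e1; apply: eq_bigr => i _; apply: eq_bigr => j _.
  by rewrite (mulrC (q 0 j)).
have e3 : \sum_(i < 8) \sum_(j < 8)
    (q 0 i * q 0 j) *: ((i == j)%:R *: obasis R ord0)
    = (\sum_(k < 8) q 0 k ^+ 2) *: obasis R ord0.
  rewrite scaler_suml; apply: eq_bigr => i _.
  rewrite (bigD1 i) //= big1 => [|j ji]; last first.
    by rewrite eq_sym (negPf ji) scale0r scaler0.
  by rewrite addr0 eqxx scale1r expr2.
by rewrite e1 e2 e3 -mulr2n -scalerMnl.
Qed.

Section Slice.
Local Open Scope complex_scope.
Variables (q : octonion R) (z : R[i]).
Hypothesis z_square :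
  z ^+ 2 = (q 0 ord0 *+ 2)%:C * z - (\sum_(k < 8) q 0 k ^+ 2)%:C.

Lemma oexp_slice k : exists A B : R,
  oexp q k = A *: obasis R ord0 + B *: q /\ z ^+ k = A%:C + B%:C * z.
Proof.
elim: k => [|k [A [B [IHq IHz]]]].
  by exists 1, 0; rewrite scale0r addr0 mul0r addr0.
(* Read off from q (A + B q) = A q + B (2 Re(q) q - |q|^2). *)
exists (- (B * \sum_(k < 8) q 0 k ^+ 2)), (A + B * (q 0 ord0 *+ 2)); split.
  rewrite /oexp iterS -/(oexp q k) IHq omulDr !omulZr omulr1 omul_square.
  by rewrite scalerBr !scalerA scaleNr scalerDl addrA addrC.
rewrite exprS IHz mulrDr mulrCA -expr2 z_square.
by rewrite rmorphN rmorphD !rmorphM /=; ring.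
Qed.

Lemma ohorner_slice p : exists A B : R,
  ohorner p q = A *: obasis R ord0 + B *: q /\
  \sum_(k < size p) (p`_k)%:C * z ^+ k = A%:C + B%:C * z.
Proof.
rewrite /ohorner; elim: (size p) => [|m [A [B [IHq IHz]]]].
  by exists 0, 0; rewrite !big_ord0 !scale0r mul0r !addr0.
have [A' [B' [eq_q eq_z]]] := oexp_slice m.
exists (A + p`_m * A'), (B + p`_m * B'); rewrite !big_ord_recr /= IHq IHz.
split; last by rewrite eq_z !rmorphD !rmorphM /=; ring.
by rewrite omul_oreal eq_q scalerDr !scalerA !scalerDl addrACA.
Qed.

End Slice.

End Octonion.

Theorem theorem3p1 (R : realType) (n : nat) (p : {poly R})
    (deg_p : size p = n.+1)
    (a0_gt0 : 0 < p`_0)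
    (a_le : forall k : nat, (k < n)%N -> p`_k <= p`_k.+1)
    (q : octonion R) (pq0 : ohorner p q = 0) :
  onorm q <= 1.
Proof.
pose N := \sum_(k < 8) q 0 k ^+ 2; pose r := q 0 ord0.
(* Here s = |Im q|, so the conjugates of z have sum 2 Re(q) and product |q|^2. *)
pose s := Num.sqrt (N - r ^+ 2); pose z : R[i] := (r +i* s)%C.
have N_im : N - r ^+ 2 = \sum_(k < 8 | k != ord0) q 0 k ^+ 2.
  by rewrite /N /r (bigD1 ord0) //= addrAC subrr add0r.
have s_square : s ^+ 2 = N - r ^+ 2.
  by rewrite sqr_sqrtr // N_im sumr_ge0 // => k _; apply: sqr_ge0.
have z_square : z ^+ 2 = ((r *+ 2)%:C * z - N%:C)%C.
  have -> : N = r ^+ 2 + s ^+ 2 by rewrite s_square addrC subrK.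
  by apply/eqP; rewrite eq_complex /=; apply/andP; split; apply/eqP; ring.
have [A [B [eq_q eq_z]]] := ohorner_slice z_square p.
(* For real q, 1 and q are dependent, so A = B = 0 cannot be inferred. Coordinates of A + B q = 0
   still give A + B r = 0 and B q_k = 0 for k > 0; hence (B s)^2, the sum of the (B q_k)^2,
   vanishes. *)
have root_z : (A%:C + B%:C * z = 0)%C.
  have coord k : A * (k == ord0)%:R + B * q 0 k = 0.
    by have /rowP/(_ k) := eq_q; rewrite pq0 !mxE eqxx /= => <-.
  have re0 : A + B * r = 0 by rewrite -(coord ord0) eqxx mulr1.
  have im0 : B * s = 0.
    apply/eqP; rewrite -sqrf_eq0 exprMn s_square N_im mulr_sumr.
    rewrite big1 // => k /negPf k0.
    by have := coord k; rewrite k0 mulr0 add0r -exprMn => ->; rewrite expr0n.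
  by apply/eqP; rewrite eq_complex /= !mul0r subr0 addr0 add0r re0 im0 eqxx.
have z_le1 : `|z| <= 1.
  apply: (@enestrom_kakeya _ n (fun k => (p`_k)%:C%C)) => [|k lekn|].
  - by rewrite ltcR.
  - by rewrite lecR a_le.
  - by rewrite -deg_p eq_z root_z.
(* |z|^2 = r^2 + s^2 = N, so |z| is [onorm q]. *)
move: z_le1; rewrite normc_def /= s_square addrC subrK.
by rewrite -(lecR _ 1).
Qed.
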